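(* Let $\Sigma=[\sigma_{hk}]$ be a $p\times p$ Hermitian positive definite complex matrix, $\alpha=(n_1,m_1,\dots,n_p,m_p)\in\mathbb Z_{\ge0}^{2p}$, $N=\{h:n_h\neq0\}$, $M=\{k:m_k\neq0\}$, $S^N_h=\{k\in M:\sigma_{hk}\neq0\}$ for $h\in N$, and $S^M_k=\{h\in N:\sigma_{hk}\neq0\}$ for $k\in M$. The moment $\nu(\alpha)$ of $\mathcal{CN}_p(\Sigma)$ equals zero if one of the following holds: (1) there exists $h\in N$ with $S^N_h=\emptyset$, or there exists $k\in M$ with $S^M_k=\emptyset$; (2) all sets $S^N_h$, $h\in N$, are nonempty and, for the partition $\{M_1,\dots,M_q\}$ of $M$ induced by the $S^N_h$'s, there exists $r\in\{1,\dots,q\}$ with $\sum_{i\in N:\ S^N_i\subset M_r}n_i\neq\sum_{j\in M_r}m_j$.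
   Context: $\mathcal{CN}_p(\Sigma)$ has density $\varphi(z;\Sigma)=\frac{1}{\pi^p\det\Sigma}\exp(-z^*\Sigma^{-1}z)$ on $\mathbb C^p\cong\mathbb R^{2p}$, and $\nu(\alpha)=\int_{\mathbb C^p}\prod_{j=1}^p z_j^{n_j}\bar z_j^{m_j}\varphi(z;\Sigma)\,dz$. The partition of $M$ induced by the $S^N_h$ is the set of connected components of the graph with vertex set $M$ in which two vertices are adjacent iff both belong to the same $S^N_h$ for some $h\in N$. *)

(* Defs.v *)
From HB Require Import structures.
From mathcomp Require Import all_boot all_order all_algebra.
From mathcomp Require Import all_classical all_reals all_analysis.
From mathcomp Require Import complex.
Set Implicit Arguments.
Unset Strict Implicit.
Unset Printing Implicit Defensive.
Import Order.TTheory GRing.Theory Num.Theory.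
Local Open Scope ring_scope.

Section CNmoments.
Context {R : realType}.

Definition rcons_coord (t : R) (x : nat -> R) : nat -> R :=
  fun k => if k is k'.+1 then x k' else t.

Fixpoint iter_Rint (k : nat) (g : (nat -> R) -> R) : R :=
  match k with
  | 0 => g (fun _ => 0)
  | k'.+1 => Rintegral (@lebesgue_measure R) setT
               (fun t => iter_Rint k' (fun x => g (rcons_coord t x)))
  end.

Variable p : nat.

(* identification C^p ~ R^{2p}: z_j = x_{2j} + i x_{2j+1} *)
Definition zcoord (x : nat -> R) (j : 'I_p) : R[i] :=
  Complex (x (2 * j)%N) (x (2 * j).+1).

Definition zvec (x : nat -> R) : 'cV[R[i]]_p := \col_j zcoord x j.

(* density of CN_p(Sigma): exp(- z^* Sigma^{-1} z) / (pi^p det Sigma);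
   z^* Sigma^{-1} z is real for Hermitian Sigma, so exp of it is expR of its real part *)
Definition CNdensity (Sigma : 'M[R[i]]_p) (x : nat -> R) : R[i] :=
  let z := zvec x in
  let q := ((map_mx Num.conj z^T) *m invmx Sigma *m z) ord0 ord0 in
  ((expR (- complex.Re q))%:C)%C / ((((pi : R) ^+ p)%:C)%C * \det Sigma).

Definition CNintegrand (Sigma : 'M[R[i]]_p) (n m : 'I_p -> nat)
    (x : nat -> R) : R[i] :=
  (\prod_(j < p) (zcoord x j ^+ n j * (Num.conj (zcoord x j)) ^+ m j))
    * CNdensity Sigma x.

Definition CNmoment (Sigma : 'M[R[i]]_p) (n m : 'I_p -> nat) : R[i] :=
  Complex (iter_Rint (2 * p) (fun x => complex.Re (CNintegrand Sigma n m x)))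
          (iter_Rint (2 * p) (fun x => complex.Im (CNintegrand Sigma n m x))).

Definition Nset (n : 'I_p -> nat) : {set 'I_p} := [set h | n h != 0%N].
Definition Mset (m : 'I_p -> nat) : {set 'I_p} := [set k | m k != 0%N].

Definition SN (Sigma : 'M[R[i]]_p) (m : 'I_p -> nat) (h : 'I_p) : {set 'I_p} :=
  [set k in Mset m | Sigma h k != 0].
Definition SM (Sigma : 'M[R[i]]_p) (n : 'I_p -> nat) (k : 'I_p) : {set 'I_p} :=
  [set h in Nset n | Sigma h k != 0].

Definition adjM (Sigma : 'M[R[i]]_p) (n m : 'I_p -> nat) : rel 'I_p :=
  fun k k' => [exists h in Nset n, (k \in SN Sigma m h) && (k' \in SN Sigma m h)].

Definition partM (Sigma : 'M[R[i]]_p) (n m : 'I_p -> nat) : {set {set 'I_p}} :=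
  equivalence_partition (connect (adjM Sigma n m)) (Mset m).

Definition hpd (Sigma : 'M[R[i]]_p) : Prop :=
  Sigma \is hermsymmx /\
  forall v : 'cV[R[i]]_p, v != 0 -> 0 < ((map_mx Num.conj v^T) *m Sigma *m v) ord0 ord0.

End CNmoments.

(* Main.v *)
Require Import Defs.
From HB Require Import structures.
From mathcomp Require Import all_boot all_order all_algebra.
From mathcomp Require Import all_classical all_reals all_analysis.
From mathcomp Require Import complex.
From mathcomp Require Import measurable_realfun ring lra zify.
Import Order.TTheory GRing.Theory Num.Theory.
Import numFieldNormedType.Exports.
Set Implicit Arguments.
Unset Strict Implicit.
Unset Printing Implicit Defensive.
Local Open Scope classical_set_scope.
Local Open Scope ring_scope.

(* Gaussian integration by parts gives Wick's recursion
     nu(n + e_h, m) = sum_j sigma_hj m_j nu(n, m - e_j).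
   Hence, if A and B are index sets such that sigma_hj <> 0 with n_h, m_j <> 0 forces
   (h in A <-> j in B), every nonzero term of the recursion removes one unit from both or from
   neither of the sums of n over A and of m over B; so nu(n, m) <> 0 implies that these sums
   agree. The theorem follows with A = {h}, B empty; A empty, B = {k}; and
   A = {i in N : S^N_i included in M_r}, B = M_r. *)

(** * Iterated integrals of dominated functions *)

(** The obstacle is that the moment is an iterated one-dimensional integral, whose linearity and
    limit theorems require integrability at every level. All integrands are therefore sequentially
    continuous and dominated by a product of functions 1/(1+t^2): fixing the outer variable
    preserves this class, and the inner integral is again continuous and dominated in that variable.
    The recursion itself comes out of a linear system. Differentiating z^n conj(z)^m exp(-z*
    Sigma^-1 z) in conj(z_j) and integrating gives m_j nu(n, m - e_j) = sum_i (Sigma^-1)_ji nu(n +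
    e_i, m) for every j, and multiplication by Sigma isolates nu(n + e_h, m). The recursion lowers
    n; when n = 0 and m <> 0, the conjugate moment is expanded instead. *)

Section IteratedIntegral.
Context {R : realType}.
Implicit Types (f g : (nat -> R) -> R) (x : nat -> R) (k : nat) (C t : R).
Let mu : {measure set _ -> \bar R} := @lebesgue_measure R.

(** The Cauchy profile 1/(1+t^2) serves as dominating function because it is integrable, loses only
    a constant factor under bounded shifts, and has a polynomial reciprocal, which a Gaussian
    absorbs. *)
Definition lorentz t : R := (oneDsqr t)^-1.

Lemma continuous_lorentz : continuous lorentz.
Proof. exact: continuous_oneDsqrV. Qed.

Lemma lorentz_gt0 t : 0 < lorentz t.
Proof. by rewrite invr_gt0. Qed.

Lemma lorentz_ge0 t : 0 <= lorentz t.
Proof. exact/ltW/lorentz_gt0. Qed.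

Lemma lorentz_le1 t : lorentz t <= 1.
Proof. exact: oneDsqrV_le1. Qed.

Lemma integrable_lorentz : mu.-integrable [set: R] (EFin \o lorentz).
Proof.
have mf : measurable_fun setT lorentz.
  by apply: continuous_measurable_fun; exact: continuous_lorentz.
apply/integrableP; split; first exact/measurable_EFinP.
apply/abse_integralP => //=; first exact/measurable_EFinP.
rewrite ge0_symfun_integralT//=.
- rewrite (_ : [set x | _] = `[0, +oo[%classic); last first.
    by apply/seteqP; split => x/=; rewrite in_itv/= andbT.
  by rewrite integral0y_oneDsqr -EFinM ltry.
- by move=> x; exact: lorentz_ge0.
- exact: continuous_lorentz.
- by move=> x/=; rewrite /lorentz /oneDsqr sqrrN.
Qed.

(** Continuity for coordinatewise convergence, in the sequential form that dominated convergence
    consumes. *)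
Definition seqcont f := forall (u : nat -> nat -> R) x,
  (forall i, u n i @[n --> \oo] --> x i) -> f (u n) @[n --> \oo] --> f x.

Definition weight k x : R := \prod_(i < k) lorentz (x i).

Definition dominated k C f := forall x, `|f x| <= C * weight k x.

Lemma weight_gt0 k x : 0 < weight k x.
Proof. by apply: prodr_gt0 => i _; exact: lorentz_gt0. Qed.

Lemma weight_rcons k t x :
  weight k.+1 (rcons_coord t x) = lorentz t * weight k x.
Proof. by rewrite /weight big_ord_recl. Qed.

Lemma dominated_ge0 k C f : dominated k C f -> 0 <= C.
Proof.
move=> /(_ (fun _ => 0)) /(le_trans (normr_ge0 _)).
by rewrite pmulr_lge0// weight_gt0.
Qed.

Lemma dominated_slice k C f t : dominated k.+1 C f ->
  dominated k (C * lorentz t) (fun x => f (rcons_coord t x)).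
Proof. by move=> Cf x; rewrite (le_trans (Cf _))// weight_rcons mulrA. Qed.

(** Dropping the factor [lorentz t] makes the bound uniform in [t], as needed when [t] runs through
    a convergent sequence; [dominated_slice] keeps the factor for integrability in [t]. *)
Lemma dominated_slice1 k C f t : dominated k.+1 C f ->
  dominated k C (fun x => f (rcons_coord t x)).
Proof.
move=> Cf x; rewrite (le_trans (dominated_slice t Cf x))//.
rewrite ler_pM2r ?weight_gt0// ler_piMr ?(dominated_ge0 Cf)//.
exact: lorentz_le1.
Qed.

Lemma seqcont_slice f t : seqcont f -> seqcont (fun x => f (rcons_coord t x)).
Proof.
by move=> cf u x ux; apply: cf => -[|i] /=; [exact: cvg_cst|exact: ux].
Qed.

Let Ie : R := Rintegral mu setT lorentz.

Definition iter_dct k := forall (f_ : nat -> (nat -> R) -> R) f C,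
  (forall n, seqcont (f_ n)) -> (forall n, dominated k C (f_ n)) ->
  seqcont f -> (forall x, f_ n x @[n --> \oo] --> f x) ->
  iter_Rint k (f_ n) @[n --> \oo] --> iter_Rint k f.

Definition iter_bound k := forall f C, seqcont f -> dominated k C f ->
  `|iter_Rint k f| <= C * Ie ^+ k.

(** Dominated convergence of the inner integrals along any sequence tending to [t]. The continuity
    obtained supplies measurability for the next integral. *)
Lemma iter_slice_cont_of_dct k : iter_dct k -> forall f C,
  seqcont f -> dominated k.+1 C f ->
  continuous (fun t => iter_Rint k (fun x => f (rcons_coord t x))).
Proof.
move=> dct f C cf Cf t; apply/(@cvg_nbhsP _ R^o) => u ut.
apply: (dct _ _ C).
- by move=> n; exact: seqcont_slice.
- by move=> n; exact: dominated_slice1.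
- exact: seqcont_slice.
- move=> x; apply: cf => -[|i] /=; [exact: ut|exact: cvg_cst].
Qed.

Lemma integrable_le_lorentz (h : R -> R) C : continuous h ->
  (forall t, `|h t| <= C * lorentz t) -> mu.-integrable [set: R] (EFin \o h).
Proof.
move=> ch Ch.
apply: (@le_integrable _ _ _ mu setT measurableT _
   (EFin \o (fun t => C * lorentz t))).
- apply/measurable_EFinP; exact: continuous_measurable_fun.
- move=> t _ /=; rewrite lee_fin (le_trans (Ch t))//; exact: ler_norm.
- rewrite [X in _.-integrable _ X](_ : _ = fun t => (C%:E * (lorentz t)%:E)%E).
    exact: (integrableZl _ _ integrable_lorentz).
  by apply/funext => t /=; rewrite EFinM.
Qed.

Lemma dominated_cvg_Rint (h_ : nat -> R -> R) (h : R -> R) C :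
  (forall n, continuous (h_ n)) -> continuous h ->
  (forall n t, `|h_ n t| <= C * lorentz t) ->
  (forall t, h_ n t @[n --> \oo] --> h t) ->
  Rintegral mu setT (h_ n) @[n --> \oo] --> Rintegral mu setT h.
Proof.
move=> ch_ ch Ch hh.
have ig : mu.-integrable [set: R] (EFin \o (fun t => C * lorentz t)).
  apply: (@integrable_le_lorentz _ `|C|).
    by move=> t; apply: cvgM; [exact: cvg_cst|exact: continuous_lorentz].
  by move=> t; rewrite normrM ler_wpM2l// ger0_norm// lorentz_ge0.
have mh_ n : measurable_fun [set: R] (EFin \o h_ n).
  by apply/measurable_EFinP; exact: continuous_measurable_fun.
have mh : measurable_fun [set: R] (EFin \o h).
  by apply/measurable_EFinP; exact: continuous_measurable_fun.
have hh' : {ae mu, forall t, [set: R] t ->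
    (h_ n t)%:E @[n --> \oo] --> (h t)%:E}.
  by apply: aeW => t _; apply: cvg_EFin; [exact: nearW|exact: hh].
have Ch' : {ae mu, forall t n, [set: R] t ->
    (`|(h_ n t)%:E| <= (C * lorentz t)%R%:E)%E}.
  by apply: aeW => t n _; rewrite /= lee_fin.
have [ih _ hint] :=
  @dominated_convergence _ _ _ mu setT measurableT (fun n => EFin \o h_ n) (EFin \o h)
    (EFin \o (fun t => C * lorentz t)) mh_ mh hh' ig Ch'.
apply: fine_cvg; rewrite fineK; first exact: hint.
exact: integrable_fin_num.
Qed.

(** Substitution is applied to nonnegative continuous integrands, so [h] is split into positive and
    negative parts; these stay continuous because max(g, 0) = (g + |g|)/2. *)
Lemma translate_Rintegral (h : R -> R) C s : continuous h ->
  (forall t, `|h t| <= C * lorentz t) ->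
  Rintegral mu setT (fun t => h (t + s)) = Rintegral mu setT h.
Proof.
move=> ch Ch; rewrite /Rintegral; congr fine.
have shift_ge0 (G : R -> R) : continuous G -> (forall t, 0 <= G t) ->
    (\int[mu]_t (G (t + s)%R)%:E = \int[mu]_t (G t)%:E)%E.
  move=> cG G0.
  have dE : derive1 (fun t : R => t + s) = cst 1.
    by apply/funext => t; rewrite derive1E derive_val addr0.
  rewrite [RHS](@increasing_ge0_integration_by_substitutionT _ (fun t => t + s))//.
  - by apply: eq_integral => t _; rewrite /= dE mulr1.
  - by move=> x y xy; rewrite ltrD2r.
  - by rewrite dE => t; exact: cvg_cst.
  - by rewrite dE; apply: is_cvg_cst.
  - by rewrite dE; apply: is_cvg_cst.
  - exact: cvg_addrr_Ny.
  - exact: cvg_addrr.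
have max_cont (g : R -> R) : continuous g -> continuous (fun t => Num.max (g t) 0).
  move=> cg; rewrite (_ : (fun t => _) = fun t => (g t + `|g t|) / 2); last first.
    by apply/funext => u; rewrite maxr_absE subr0 addr0.
  move=> t; apply: cvgM; last exact: cvg_cst.
  by apply: cvgD; [exact: cg|apply: cvg_norm; exact: cg].
have max_ge0 (g : R -> R) t : 0 <= Num.max (g t) 0 by rewrite le_max lexx orbT.
have cNh : continuous (fun t => - h t) by move=> t; apply: cvgN; exact: ch.
have posE (g : R -> R) :
    ((fun t => (g t)%:E)^\+)%E = (fun t => (Num.max (g t) 0)%:E).
  by apply/funext => t; rewrite funeposE EFin_max.
have negE (g : R -> R) :
    ((fun t => (g t)%:E)^\-)%E = (fun t => (Num.max (- g t) 0)%:E).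
  by apply/funext => t; rewrite funenegE EFin_max EFinN.
rewrite integralE [RHS]integralE !posE !negE; congr (_ - _)%E.
- by apply: (shift_ge0 (fun t => Num.max (h t) 0)) => //; exact: max_cont.
- by apply: (shift_ge0 (fun t => Num.max (- h t) 0)) => //; exact: max_cont.
Qed.

(** The two claims need a joint induction: the outer integrand is continuous by dominated
    convergence in dimension [k], and dominated by the bound in dimension [k]. *)
Lemma iter_dct_bound k : iter_dct k /\ iter_bound k.
Proof.
elim: k => [|k [dct bnd]]; split.
- by move=> f_ f C _ _ _ ff; exact: ff.
- by move=> f C _ Cf; rewrite (le_trans (Cf _))// /weight big_ord0 expr0.
- move=> f_ f C cf_ Cf_ cf ff /=.
  (* The common bound of the [f_ n] passes to their pointwise limit. *)
  have Cf : dominated k.+1 C f.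
    move=> x; rewrite -(cvg_lim _ (cvg_norm (ff x)))//.
    apply: limr_le; first by apply/cvg_ex; exists `|f x|; exact: cvg_norm.
    by apply: nearW => n; exact: Cf_.
  apply: (dominated_cvg_Rint (C := C * Ie ^+ k)).
  + by move=> n; exact: iter_slice_cont_of_dct.
  + exact: iter_slice_cont_of_dct.
  + move=> n t; rewrite mulrAC; apply: bnd; first exact: seqcont_slice.
    exact: dominated_slice.
  + move=> t; apply: (dct _ _ C).
    * by move=> n; exact: seqcont_slice.
    * by move=> n; exact: dominated_slice1.
    * exact: seqcont_slice.
    * by move=> x; exact: ff.
- move=> f C cf Cf /=.
  have ch := iter_slice_cont_of_dct dct cf Cf.
  have Ch t : `|iter_Rint k (fun x => f (rcons_coord t x))| <= C * Ie ^+ k * lorentz t.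
    rewrite mulrAC; apply: bnd; first exact: seqcont_slice.
    exact: dominated_slice.
  rewrite (le_trans (le_normr_Rintegral _ (integrable_le_lorentz ch Ch)))//.
  have C0 : 0 <= C * Ie ^+ k.
    by have := le_trans (normr_ge0 _) (Ch 0); rewrite pmulr_lge0// lorentz_gt0.
  rewrite exprSr mulrA -RintegralZl//; last exact: integrable_lorentz.
  apply: le_Rintegral => //.
  + apply: (integrable_le_lorentz (C := C * Ie ^+ k)).
      by move=> t; apply: cvg_norm; exact: ch.
    by move=> t; rewrite normr_id.
  + apply: (integrable_le_lorentz (C := C * Ie ^+ k)).
      by move=> t; apply: cvgM; [exact: cvg_cst|exact: continuous_lorentz].
    by move=> t; rewrite ger0_norm// mulr_ge0// lorentz_ge0.
Qed.

Lemma iter_slice_cont k f C : seqcont f -> dominated k.+1 C f ->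
  continuous (fun t => iter_Rint k (fun x => f (rcons_coord t x))).
Proof. exact: iter_slice_cont_of_dct (iter_dct_bound k).1 _ _. Qed.

Lemma iter_slice_bound k f C t : seqcont f -> dominated k.+1 C f ->
  `|iter_Rint k (fun x => f (rcons_coord t x))| <= C * Ie ^+ k * lorentz t.
Proof.
move=> cf Cf; rewrite mulrAC; apply: (iter_dct_bound k).2.
  exact: seqcont_slice.
exact: dominated_slice.
Qed.

Lemma integrable_slice k f C : seqcont f -> dominated k.+1 C f ->
  mu.-integrable [set: R] (EFin \o (fun t => iter_Rint k (fun x => f (rcons_coord t x)))).
Proof.
move=> cf Cf; apply: integrable_le_lorentz (iter_slice_cont cf Cf) _ => t.
exact: iter_slice_bound.
Qed.

(** The class on which [iter_Rint] is linear: every slice integral is then integrable in the outer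
    variable. *)
Definition integrand k f := seqcont f /\ exists C, dominated k C f.

Lemma integrand_slice k f t : integrand k.+1 f ->
  integrand k (fun x => f (rcons_coord t x)).
Proof.
move=> [cf [C Cf]]; split; first exact: seqcont_slice.
by exists C; exact: dominated_slice1.
Qed.

Lemma iter_RintD k f g : integrand k f -> integrand k g ->
  iter_Rint k (fun x => f x + g x) = iter_Rint k f + iter_Rint k g.
Proof.
elim: k f g => [//|k IH] f g If Ig /=.
have [[cf [C Cf]] [cg [D Dg]]] := (If, Ig).
rewrite -RintegralD//; [|exact: integrable_slice Cf|exact: integrable_slice Dg].
by apply: eq_Rintegral => t _; rewrite IH//; exact: integrand_slice.
Qed.

Lemma iter_RintZ k c f : integrand k f ->
  iter_Rint k (fun x => c * f x) = c * iter_Rint k f.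
Proof.
elim: k f => [//|k IH] f If /=.
have [cf [C Cf]] := If.
rewrite -RintegralZl//; last exact: integrable_slice Cf.
by apply: eq_Rintegral => t _; rewrite IH//; exact: integrand_slice.
Qed.

Lemma integrandD k f g : integrand k f -> integrand k g ->
  integrand k (fun x => f x + g x).
Proof.
move=> [cf [C Cf]] [cg [D Dg]]; split.
  by move=> u x ux; apply: cvgD; [exact: cf|exact: cg].
exists (C + D) => x; rewrite mulrDl (le_trans (ler_normD _ _))//.
exact: lerD.
Qed.

Lemma integrandZ k c f : integrand k f -> integrand k (fun x => c * f x).
Proof.
move=> [cf [C Cf]]; split.
  by move=> u x ux; apply: cvgM; [exact: cvg_cst|exact: cf].
by exists (`|c| * C) => x; rewrite normrM -mulrA ler_wpM2l.
Qed.

Definition upd x i t : nat -> R := fun j => if j == i then t else x j.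

Lemma seqcont_upd f i s : seqcont f -> seqcont (fun x => f (upd x i (x i + s))).
Proof.
move=> cf u x ux; apply: cf => j; rewrite /upd; case: eqP => _; last exact: ux.
by apply: cvgD; [exact: ux|exact: cvg_cst].
Qed.

Lemma lorentz_shift t s : `|s| <= 1 -> lorentz (t + s) <= 3 * lorentz t.
Proof.
move=> s1; rewrite /lorentz -[leLHS]mul1r ler_pdivrMr// mulrAC ler_pdivlMr//.
have s2 : s ^+ 2 <= 1 by rewrite -real_normK ?num_real// expr_le1.
(* The constant 3 works since 3(1+(t+s)^2) - (1+t^2) = (t+2s)^2 + (t+s)^2 + 2(1-s^2). *)
by rewrite /oneDsqr; have := sqr_ge0 (t + 2 * s); nra.
Qed.

Lemma weight_upd k x i s : `|s| <= 1 -> weight k (upd x i (x i + s)) <= 3 * weight k x.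
Proof.
move=> s1; have [ik|ki] := ltnP i k; last first.
  rewrite [leLHS](_ : _ = weight k x).
    by have := weight_gt0 k x; lra.
  apply: eq_bigr => j _; rewrite /upd; case: eqP => // ji.
  by move: (ltn_ord j); rewrite ji ltnNge ki.
rewrite /weight (bigD1 (Ordinal ik))//= [in leRHS](bigD1 (Ordinal ik))//= mulrA.
rewrite (_ : upd x i (x i + s) i = x i + s); last by rewrite /upd eqxx.
rewrite [X in _ * X <= _](_ : _ = \prod_(j < k | j != Ordinal ik) lorentz (x j)); last first.
  by apply: eq_bigr => j; rewrite /upd -val_eqE /= => /negbTE ->.
rewrite ler_wpM2r ?lorentz_shift//.
by apply: prodr_ge0 => j _; exact: lorentz_ge0.
Qed.

Lemma iter_Rint_translate k f i s : integrand k f -> `|s| <= 1 -> (i < k)%N ->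
  iter_Rint k (fun x => f (upd x i (x i + s))) = iter_Rint k f.
Proof.
elim: k f i => [//|k IH] f [|i] If s1 ik /=.
  have [cf [C Cf]] := If.
  rewrite -(translate_Rintegral s (iter_slice_cont cf Cf)
    (fun t => iter_slice_bound t cf Cf)).
  apply: eq_Rintegral => t _; congr (iter_Rint k); apply/funext => x.
  by congr f; apply/funext => -[].
apply: eq_Rintegral => t _; rewrite -[RHS](IH _ i)//; last exact: integrand_slice.
congr (iter_Rint k); apply/funext => x.
by congr f; apply/funext => -[].
Qed.

Definition pderiv i f f' := forall x,
  is_derive (x i) 1 (fun t => f (upd x i t)) (f' x).

(* Difference quotients in direction [i] have integral zero by translation invariance, and
   converge to the derivative under the integral sign, so no Fubini theorem is needed. *)
Lemma iter_Rint_pderiv k i f f' : integrand k f -> integrand k f' -> (i < k)%N ->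
  pderiv i f f' -> iter_Rint k f' = 0.
Proof.
move=> If If' ik df.
(* The increment 1/(n+1) is at most 1, so that [weight_upd] controls the shifted weight. *)
pose q n x := n.+1%:R * (f (upd x i (x i + n.+1%:R^-1)) + -1 * f x).
have n1 n : `|n.+1%:R^-1 : R| <= 1.
  by rewrite normfV ger0_norm// invf_le1// ler1n.
have Iu n : integrand k (fun x => f (upd x i (x i + n.+1%:R^-1))).
  have [cf [C Cf]] := If; split; first exact: seqcont_upd.
  exists (C * 3) => x; rewrite (le_trans (Cf _))// -mulrA ler_wpM2l//.
    exact: dominated_ge0 Cf.
  exact: weight_upd.
have [cf' [C Cf']] := If'.
have q0 n : iter_Rint k (q n) = 0.
  rewrite iter_RintZ; last by apply: integrandD => //; exact: integrandZ.
  rewrite iter_RintD// ?iter_RintZ//; last exact: integrandZ.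
  by rewrite iter_Rint_translate// mulN1r subrr mulr0.
(* By the mean value theorem the quotient is a value of [f'] nearby. Domination of [f'] then bounds
   all quotients at once, and continuity of [f'] gives their limit. *)
have qE n x : exists c, `|c| <= n.+1%:R^-1 /\ q n x = f' (upd x i (x i + c)).
  have upd2 t s : upd (upd x i t) i s = upd x i s.
    by apply/funext => j; rewrite /upd; case: eqP.
  have updx : upd x i (x i) = x.
    by apply/funext => j; rewrite /upd; case: eqP => // ->.
  have dx t : is_derive t 1 (fun t => f (upd x i t)) (f' (upd x i t)).
    have := df (upd x i t); rewrite {1}/upd eqxx.
    by under eq_fun do rewrite upd2.
  have cfx : {within `[x i, x i + n.+1%:R^-1], continuous (fun t => f (upd x i t))}.
    apply: continuous_subspaceT => t.
    by apply/differentiable_continuous/derivable1_diffP; case: (dx t).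
  have lex : x i <= x i + n.+1%:R^-1 by rewrite lerDl.
  have [c] := MVT_segment lex (fun t _ => dx t) cfx.
  rewrite in_itv/= updx => /andP[c1 c2] fc; exists (c - x i); split.
    by rewrite ger0_norm ?subr_ge0// lerBlDl.
  by rewrite /q mulN1r fc addrC addKr mulrC mulfVK// addrC subrK.
have Cq n : dominated k (C * 3) (q n).
  move=> x; have [c [cn ->]] := qE n x.
  rewrite (le_trans (Cf' _))// -mulrA ler_wpM2l//; first exact: dominated_ge0 Cf'.
  apply: weight_upd; rewrite (le_trans cn)//.
  by have := n1 n; rewrite ger0_norm.
have fq x : q n x @[n --> \oo] --> f' x.
  have [c cP] := choice (fun n => qE n x).
  rewrite (_ : (fun n => q n x) = fun n => f' (upd x i (x i + c n))); last first.
    by apply/funext => n; exact: (cP n).2.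
  apply: cf' => j; rewrite /upd; case: eqP => [->|_]; last exact: cvg_cst.
  rewrite -[X in _ --> X]addr0; apply: cvgD; first exact: cvg_cst.
  apply/norm_cvg0P.
  apply: (@squeeze_cvgr _ _ _ _ (cst 0) (fun n => n.+1%:R^-1)).
  - by apply: nearW => n /=; rewrite normr_ge0 (cP n).1.
  - exact: cvg_cst.
  - exact: cvg_harmonic.
have cq n : seqcont (q n).
  suff : integrand k (q n) by case.
  by apply: integrandZ; apply: integrandD => //; exact: integrandZ.
have := (iter_dct_bound k).1 q f' (C * 3) cq Cq cf' fq.
under eq_fun do rewrite q0.
by move=> /(cvg_lim (@Rhausdorff R)) <-; rewrite lim_cst.
Qed.

End IteratedIntegral.

(** * Polynomial growth against a Gaussian *)

Section PolynomialGrowth.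
Context {R : realType}.
Implicit Types (f g : (nat -> R) -> R) (x : nat -> R) (k : nat) (c t : R).

Lemma upd_id x i : upd x i (x i) = x.
Proof. by apply/funext => j; rewrite /upd; case: eqP => // ->. Qed.

Lemma pderiv_cst i c : pderiv i (fun _ => c) (fun _ => 0).
Proof. by move=> x; exact: is_derive_cst. Qed.

Lemma pderiv_coord i a : pderiv i (fun x : nat -> R => x a) (fun _ => (a == i)%:R).
Proof.
move=> x; rewrite /upd; case: (a == i); last exact: is_derive_cst.
exact: is_derive_id.
Qed.

Lemma pderivD i f f' g g' : pderiv i f f' -> pderiv i g g' ->
  pderiv i (fun x => f x + g x) (fun x => f' x + g' x).
Proof. by move=> df dg x; exact: (is_deriveD (df x) (dg x)). Qed.

Lemma pderivN i f f' : pderiv i f f' -> pderiv i (fun x => - f x) (fun x => - f' x).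
Proof. by move=> df x; exact: (is_deriveN (df x)). Qed.

Lemma pderivM i f f' g g' : pderiv i f f' -> pderiv i g g' ->
  pderiv i (fun x => f x * g x) (fun x => f' x * g x + f x * g' x).
Proof.
move=> df dg x; apply: is_derive_eq; first exact: (is_deriveM (df x) (dg x)).
by rewrite /= !upd_id /GRing.scale /=; ring.
Qed.

Lemma pderiv_expRN i f f' : pderiv i f f' ->
  pderiv i (fun x => expR (- f x)) (fun x => - f' x * expR (- f x)).
Proof.
move=> df x; apply: is_derive_eq.
  exact: (is_derive1_comp (is_derive_expR _) (pderivN df x)).
by rewrite /= upd_id mulrC.
Qed.

(** Uniqueness of derivatives; it shows that the partial derivatives of a real-valued complex
    function are real. *)
Lemma pderiv_cst_eq0 i c f' : pderiv i (fun _ => c) f' -> f' = (fun _ => 0).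
Proof.
move=> df; apply/funext => x.
by rewrite -(@derive_val _ _ _ _ _ _ _ (df x)) derive_cst.
Qed.

Lemma eq_pderiv i f g f' g' : f =1 g -> f' =1 g' -> pderiv i f f' -> pderiv i g g'.
Proof. by move=> /funext -> /funext ->. Qed.

Definition sqn k x : R := \sum_(i < k) x i ^+ 2.

Lemma sqn_ge0 k x : 0 <= sqn k x.
Proof. by apply: sumr_ge0 => i _; exact: sqr_ge0. Qed.

Lemma sqn_ge1 k x : 1 <= 1 + sqn k x.
Proof. by rewrite lerDl sqn_ge0. Qed.

(** The base 1 + |x|^2 is at least 1, so powers grow with the exponent and bounds of different
    degrees can be added. *)
Definition polyg k f := seqcont f /\
  exists C d, forall x, `|f x| <= C * (1 + sqn k x) ^+ d.

Lemma polyg_cst_ge0 k f (C : R) d :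
  (forall x, `|f x| <= C * (1 + sqn k x) ^+ d) -> 0 <= C.
Proof.
move=> /(_ (fun=> 0)) /(le_trans (normr_ge0 _)).
by rewrite pmulr_lge0// exprn_gt0// (lt_le_trans ltr01) ?sqn_ge1.
Qed.

Lemma polyg_cst k c : polyg k (fun _ => c).
Proof.
split; first by move=> u x _; exact: cvg_cst.
by exists `|c|, 0%N => x; rewrite expr0 mulr1.
Qed.

Lemma sqn_coord k x a : (a < k)%N -> x a ^+ 2 <= sqn k x.
Proof.
move=> ak; rewrite /sqn (bigD1 (Ordinal ak))//= lerDl.
by apply: sumr_ge0 => i _; exact: sqr_ge0.
Qed.

Lemma polyg_coord k a : (a < k)%N -> polyg k (fun x => x a).
Proof.
move=> ak; split; first by move=> u x; exact.
exists 1, 1%N => x; rewrite mul1r expr1.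
have := sqn_coord x ak; rewrite -real_normK ?num_real// => h.
by have := sqr_ge0 (`|x a| - 1); nra.
Qed.

Lemma polygD k f g : polyg k f -> polyg k g -> polyg k (fun x => f x + g x).
Proof.
move=> [cf [C [d Cf]]] [cg [D [e Dg]]]; split.
  by move=> u x ux; apply: cvgD; [exact: cf|exact: cg].
have C0 := polyg_cst_ge0 Cf; have D0 := polyg_cst_ge0 Dg.
exists (C + D), (d + e)%N => x; rewrite mulrDl (le_trans (ler_normD _ _))//.
apply: lerD; rewrite (le_trans (Cf _), le_trans (Dg _))// ler_wpM2l// ler_weXn2l ?sqn_ge1//.
  exact: leq_addr.
exact: leq_addl.
Qed.

Lemma polygM k f g : polyg k f -> polyg k g -> polyg k (fun x => f x * g x).
Proof.
move=> [cf [C [d Cf]]] [cg [D [e Dg]]]; split.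
  by move=> u x ux; apply: cvgM; [exact: cf|exact: cg].
exists (C * D), (d + e)%N => x; rewrite normrM exprD mulrACA.
exact: ler_pM.
Qed.

Lemma polygN k f : polyg k f -> polyg k (fun x => - f x).
Proof.
move=> /(polygM (polyg_cst k (-1))).
by under eq_fun do rewrite mulN1r.
Qed.

Lemma expn_le_expR (n : nat) t : 0 <= t -> t ^+ n <= n`!%:R * expR t.
Proof.
case: n => [|n] t0; first by rewrite expr0 mul1r -expR0 ler_expR.
rewrite mulrC -ler_pdivrMr ?ltr0n ?fact_gt0//.
by apply: le_trans (expR_ge1Dxn n t0); rewrite lerDr.
Qed.

Lemma weightV_le k x : (weight k x)^-1 <= (1 + sqn k x) ^+ k.
Proof.
rewrite /weight -prodfV.
rewrite [leRHS](_ : _ = \prod_(i < k) (1 + sqn k x)); last first.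
  by rewrite prodr_const card_ord.
apply: ler_prod => i _; rewrite invrK (le_trans ler01) ?oneDsqr_ge1//=.
by rewrite /oneDsqr lerD2l sqn_coord.
Qed.

Definition coercive k (q : (nat -> R) -> R) := exists2 c, 0 < c & forall x, c * sqn k x <= q x.

Lemma integrand_gauss k f q : polyg k f -> seqcont q -> coercive k q ->
  integrand k (fun x => f x * expR (- q x)).
Proof.
move=> [cf [C [d Cf]]] cq [c c0 qc]; split.
  move=> u x ux; apply: cvgM; first exact: cf.
  apply: (cvg_comp (fun n => - q (u n)) expR); last exact: continuous_expR.
  by apply: cvgN; exact: cq.
(* Degree [d] accounts for the growth of [f], and [k] for the reciprocal of the weight. *)
pose N := (d + k)%N.
have C0 := polyg_cst_ge0 Cf.
(* With s = |x|^2, the inequality (c(1+s))^N <= N! exp(c(1+s)) yields (1+s)^N exp(-c s) <= N! e^c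
   c^-N. *)
exists (C * (expR c * N`!%:R * c ^- N)) => x.
rewrite normrM (ger0_norm (expR_ge0 _)).
apply: (@le_trans _ _ (C * (1 + sqn k x) ^+ d * expR (- (c * sqn k x)))).
  by rewrite ler_pM ?expR_ge0// ler_expR lerN2.
rewrite -[leLHS]mulrA -[leRHS]mulrA ler_wpM2l// -ler_pdivrMr ?weight_gt0//.
have h : (1 + sqn k x) ^+ d * expR (- (c * sqn k x)) * (weight k x)^-1 <=
    (1 + sqn k x) ^+ N * expR (- (c * sqn k x)).
  rewrite /N exprD mulrAC ler_wpM2r ?expR_ge0// ler_wpM2l ?weightV_le//.
  by rewrite exprn_ge0// (le_trans ler01) ?sqn_ge1.
rewrite (le_trans h)//.
have := expn_le_expR N (_ : 0 <= c * (1 + sqn k x)).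
rewrite mulr_ge0 ?(ltW c0)//; last by rewrite (le_trans ler01) ?sqn_ge1.
move=> /(_ isT); rewrite exprMn mulrDr mulr1 expRD expRN => hh.
rewrite ler_pdivrMr ?expR_gt0// mulrAC ler_pdivlMr ?exprn_gt0//.
by rewrite [leLHS]mulrC (le_trans hh)// mulrA [N`!%:R * _]mulrC.
Qed.

End PolynomialGrowth.

(** * Wirtinger derivatives *)

Section Wirtinger.
Context {R : realType}.
Variable p : nat.
Let k := (2 * p)%N.
Implicit Types (F G H : (nat -> R) -> R[i]) (x : nat -> R).

Lemma creM (z w : R[i]) : complex.Re (z * w) =
  complex.Re z * complex.Re w - complex.Im z * complex.Im w.
Proof. by case: z w => [a b] [c d]. Qed.

Lemma cimM (z w : R[i]) : complex.Im (z * w) =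
  complex.Re z * complex.Im w + complex.Im z * complex.Re w.
Proof. by case: z w => [a b] [c d]. Qed.

Lemma creD (z w : R[i]) : complex.Re (z + w) = complex.Re z + complex.Re w.
Proof. by case: z w => [a b] [c d]. Qed.

Lemma cimD (z w : R[i]) : complex.Im (z + w) = complex.Im z + complex.Im w.
Proof. by case: z w => [a b] [c d]. Qed.

Lemma creN (z : R[i]) : complex.Re (- z) = - complex.Re z.
Proof. by case: z. Qed.

Lemma cimN (z : R[i]) : complex.Im (- z) = - complex.Im z.
Proof. by case: z. Qed.

Definition cpolyg F := polyg k (fun x => complex.Re (F x)) /\ polyg k (fun x => complex.Im (F x)).

Definition cpderiv i F G := pderiv i (fun x => complex.Re (F x)) (fun x => complex.Re (G x)) /\
  pderiv i (fun x => complex.Im (F x)) (fun x => complex.Im (G x)).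

Lemma cpolyg_cst (c : R[i]) : cpolyg (fun _ => c).
Proof. by split; exact: polyg_cst. Qed.

Lemma cpolygD F G : cpolyg F -> cpolyg G -> cpolyg (fun x => F x + G x).
Proof.
move=> [rF iF] [rG iG]; split.
  by under eq_fun do rewrite creD; exact: polygD.
by under eq_fun do rewrite cimD; exact: polygD.
Qed.

Lemma cpolygM F G : cpolyg F -> cpolyg G -> cpolyg (fun x => F x * G x).
Proof.
move=> [rF iF] [rG iG]; split.
  under eq_fun do rewrite creM; apply: polygD; first exact: polygM.
  by apply: polygN; exact: polygM.
by under eq_fun do rewrite cimM; apply: polygD; exact: polygM.
Qed.

Lemma cpderivD i F F' G G' : cpderiv i F F' -> cpderiv i G G' ->
  cpderiv i (fun x => F x + G x) (fun x => F' x + G' x).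
Proof.
move=> [rF iF] [rG iG]; split.
  by apply: eq_pderiv (pderivD rF rG) => x; rewrite creD.
by apply: eq_pderiv (pderivD iF iG) => x; rewrite cimD.
Qed.

Lemma cpderivM i F F' G G' : cpderiv i F F' -> cpderiv i G G' ->
  cpderiv i (fun x => F x * G x) (fun x => F' x * G x + F x * G' x).
Proof.
move=> [rF iF] [rG iG]; split.
  apply: eq_pderiv (pderivD (pderivM rF rG) (pderivN (pderivM iF iG))) => x.
    by rewrite creM.
  by rewrite creD !creM; ring.
apply: eq_pderiv (pderivD (pderivM rF iG) (pderivM iF rG)) => x; first by rewrite cimM.
by rewrite cimD !cimM; ring.
Qed.

Lemma cpderiv_cst i (c : R[i]) : cpderiv i (fun _ => c) (fun _ => 0).
Proof. by split; exact: pderiv_cst. Qed.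

(* [wirtinger j F G]: G is twice the derivative of F with respect to the conjugate of z_j. *)
Definition wirtinger (j : 'I_p) F G := cpolyg F /\ exists Fx Fy,
  [/\ cpolyg Fx, cpolyg Fy, cpderiv (2 * j)%N F Fx, cpderiv (2 * j).+1 F Fy &
  G = fun x => Fx x + 'i%C * Fy x].

Lemma eq_wirtinger j F G F' G' : F =1 G -> F' =1 G' ->
  wirtinger j F F' -> wirtinger j G G'.
Proof. by move=> /funext -> /funext ->. Qed.

Lemma wirtinger_cst j (c : R[i]) : wirtinger j (fun _ => c) (fun _ => 0).
Proof.
split; first exact: cpolyg_cst.
exists (fun _ => 0), (fun _ => 0); split; try exact: cpolyg_cst; try exact: cpderiv_cst.
by apply/funext => x; rewrite mulr0 addr0.
Qed.

Lemma wirtingerD j F F' G G' : wirtinger j F F' -> wirtinger j G G' ->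
  wirtinger j (fun x => F x + G x) (fun x => F' x + G' x).
Proof.
move=> [pF [Fx [Fy [pFx pFy dFx dFy ->]]]] [pG [Gx [Gy [pGx pGy dGx dGy ->]]]].
split; first exact: cpolygD.
exists (fun x => Fx x + Gx x), (fun x => Fy x + Gy x).
split; try exact: cpolygD; try exact: cpderivD.
by apply/funext => x; rewrite mulrDr addrACA.
Qed.

Lemma wirtingerM j F F' G G' : wirtinger j F F' -> wirtinger j G G' ->
  wirtinger j (fun x => F x * G x) (fun x => F' x * G x + F x * G' x).
Proof.
move=> [pF [Fx [Fy [pFx pFy dFx dFy ->]]]] [pG [Gx [Gy [pGx pGy dGx dGy ->]]]].
split; first exact: cpolygM.
exists (fun x => Fx x * G x + F x * Gx x), (fun x => Fy x * G x + F x * Gy x).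
split; try (by apply: cpolygD; exact: cpolygM); try exact: cpderivM.
by apply/funext => x; ring.
Qed.

Lemma wirtingerZ j (c : R[i]) F F' : wirtinger j F F' ->
  wirtinger j (fun x => c * F x) (fun x => c * F' x).
Proof.
by move=> /(wirtingerM (wirtinger_cst j c)); apply: eq_wirtinger => x //; rewrite mul0r add0r.
Qed.

(** At [n = 0] the truncated exponent [n.-1] is harmless, its coefficient being zero. *)
Lemma wirtingerX j n F F' : wirtinger j F F' ->
  wirtinger j (fun x => F x ^+ n) (fun x => n%:R * F x ^+ n.-1 * F' x).
Proof.
move=> dF; elim: n => [|n IH].
  by apply: eq_wirtinger (wirtinger_cst j 1) => x; rewrite ?expr0 ?mul0r.
apply: eq_wirtinger (wirtingerM dF IH) => x /=; first by rewrite exprS.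
by case: n {IH} => [|n] /=; rewrite ?expr0 ?exprS -?[n.+2%:R]natr1; ring.
Qed.

Lemma wirtinger_sum j (I : Type) (r : seq I) (F F' : I -> (nat -> R) -> R[i]) :
  (forall i, wirtinger j (F i) (F' i)) ->
  wirtinger j (fun x => \sum_(i <- r) F i x) (fun x => \sum_(i <- r) F' i x).
Proof.
move=> dF; elim: r => [|a r IH].
  by apply: eq_wirtinger (wirtinger_cst j 0) => x; rewrite big_nil.
by apply: eq_wirtinger (wirtingerD (dF a) IH) => x; rewrite big_cons.
Qed.

Lemma wirtinger_prod0 j (I : Type) (r : seq I) (P : pred I) (F : I -> (nat -> R) -> R[i]) :
  (forall i, P i -> wirtinger j (F i) (fun _ => 0)) ->
  wirtinger j (fun x => \prod_(i <- r | P i) F i x) (fun _ => 0).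
Proof.
move=> dF; elim: r => [|a r IH].
  by apply: eq_wirtinger (wirtinger_cst j 1) => x; rewrite ?big_nil.
case Pa : (P a); last by apply: eq_wirtinger IH => x //; rewrite big_cons Pa.
apply: eq_wirtinger (wirtingerM (dF _ Pa) IH) => x; first by rewrite big_cons Pa.
by rewrite mul0r mulr0 addr0.
Qed.

Lemma conjcE (z : R[i]) : Num.conj z = conjc z.
Proof. by []. Qed.

(** The sign [s] treats a coordinate ([s = 1]) and its conjugate ([s = -1]) alike. *)
Lemma cpolyg_coord (F : (nat -> R) -> R[i]) a b (s : R) : (a < k)%N -> (b < k)%N ->
  (forall x, F x = Complex (x a) (s * x b)) -> cpolyg F.
Proof.
move=> ak bk FE; split; under eq_fun do rewrite FE /=; first exact: polyg_coord.
by apply: polygM; [exact: polyg_cst|exact: polyg_coord].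
Qed.

Lemma cpderiv_coord i (F : (nat -> R) -> R[i]) a b (s : R) :
  (forall x, F x = Complex (x a) (s * x b)) ->
  cpderiv i F (fun _ => Complex (a == i)%:R (s * (b == i)%:R)).
Proof.
move=> FE; split.
  by apply: eq_pderiv (pderiv_coord i a) => x //; rewrite FE.
apply: eq_pderiv (pderivM (pderiv_cst i s) (pderiv_coord i b)) => x.
  by rewrite FE.
by rewrite /= mul0r add0r.
Qed.

Lemma coord_lt (j : 'I_p) : (2 * j < k)%N /\ ((2 * j).+1 < k)%N.
Proof. by rewrite /k; have := ltn_ord j; split; lia. Qed.

(** The Cauchy-Riemann equations: for h = j the contributions 1 and i^2 cancel. Mixed terms vanish
    because an even index never equals an odd one. *)
Lemma wirtinger_zcoord (j h : 'I_p) : wirtinger j (fun x => zcoord x h) (fun _ => 0).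
Proof.
have zE x : zcoord x h = Complex (x (2 * h)%N) (1 * x (2 * h).+1) by rewrite mul1r.
have [h1 h2] := coord_lt h.
split; first exact: cpolyg_coord h1 h2 zE.
exists (fun=> Complex (2 * h == 2 * j)%N%:R (1 * ((2 * h).+1 == 2 * j)%N%:R)).
exists (fun=> Complex (2 * h == (2 * j).+1)%N%:R (1 * ((2 * h).+1 == (2 * j).+1)%N%:R)).
split; try exact: cpolyg_cst; try exact: cpderiv_coord zE.
apply/funext => x; rewrite (_ : (2 * h).+1 == 2 * j = false)%N; last by apply/eqP; lia.
rewrite (_ : 2 * h == (2 * j).+1 = false)%N; last by apply/eqP; lia.
rewrite eqSS; apply/eqP; rewrite eq_complex creD cimD creM cimM /=.
by apply/andP; split; apply/eqP; ring.
Qed.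

(** Conjugation turns the cancelling 1 + i^2 into 1 - i^2 = 2. *)
Lemma wirtinger_zconj (j h : 'I_p) :
  wirtinger j (fun x => Num.conj (zcoord x h)) (fun _ => 2 * (h == j)%:R).
Proof.
have zE x : Num.conj (zcoord x h) = Complex (x (2 * h)%N) (-1 * x (2 * h).+1).
  by rewrite conjcE mulN1r.
have [h1 h2] := coord_lt h.
split; first exact: cpolyg_coord h1 h2 zE.
exists (fun=> Complex (2 * h == 2 * j)%N%:R (-1 * ((2 * h).+1 == 2 * j)%N%:R)).
exists (fun=> Complex (2 * h == (2 * j).+1)%N%:R (-1 * ((2 * h).+1 == (2 * j).+1)%N%:R)).
split; try exact: cpolyg_cst; try exact: cpderiv_coord zE.
apply/funext => x; rewrite (_ : (2 * h).+1 == 2 * j = false)%N; last by apply/eqP; lia.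
rewrite (_ : 2 * h == (2 * j).+1 = false)%N; last by apply/eqP; lia.
rewrite eqSS eqn_pmul2l// val_eqE; apply/eqP; rewrite eq_complex creD cimD !creM !cimM /=.
by case: (h == j) => /=; apply/andP; split; apply/eqP; rewrite /=; ring.
Qed.

End Wirtinger.

(** * Linearity of the iterated integral for complex-valued integrands *)

Section ComplexIntegral.
Context {R : realType}.
Variable k : nat.
Implicit Types (F G : (nat -> R) -> R[i]) (x : nat -> R).

Definition iter_Cint F : R[i] :=
  Complex (iter_Rint k (fun x => complex.Re (F x))) (iter_Rint k (fun x => complex.Im (F x))).

Definition cintegrand F :=
  integrand k (fun x => complex.Re (F x)) /\ integrand k (fun x => complex.Im (F x)).

Lemma eq_iter_Cint F G : F =1 G -> iter_Cint F = iter_Cint G.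
Proof. by move=> /funext ->. Qed.

Lemma eq_integrand (f g : (nat -> R) -> R) : f =1 g -> integrand k f -> integrand k g.
Proof. by move=> /funext ->. Qed.

Lemma eq_iter_Rint (f g : (nat -> R) -> R) : f =1 g -> iter_Rint k f = iter_Rint k g.
Proof. by move=> /funext ->. Qed.

Lemma cintegrandD F G : cintegrand F -> cintegrand G -> cintegrand (fun x => F x + G x).
Proof.
move=> [rF iF] [rG iG]; split.
  by apply: eq_integrand (integrandD rF rG) => x; rewrite creD.
by apply: eq_integrand (integrandD iF iG) => x; rewrite cimD.
Qed.

Lemma cintegrandZ c F : cintegrand F -> cintegrand (fun x => c * F x).
Proof.
move=> [rF iF]; split.
  apply: eq_integrand (integrandD (integrandZ (complex.Re c) rF)
    (integrandZ (- complex.Im c) iF)) => x.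
  by rewrite creM mulNr.
apply: eq_integrand (integrandD (integrandZ (complex.Re c) iF)
  (integrandZ (complex.Im c) rF)) => x.
by rewrite cimM.
Qed.

Lemma iter_CintD F G : cintegrand F -> cintegrand G ->
  iter_Cint (fun x => F x + G x) = iter_Cint F + iter_Cint G.
Proof.
move=> [rF iF] [rG iG]; apply/eqP; rewrite eq_complex creD cimD /=.
rewrite -!iter_RintD//; apply/andP; split; apply/eqP/eq_iter_Rint => x; first by rewrite creD.
by rewrite cimD.
Qed.

Lemma iter_CintZ c F : cintegrand F -> iter_Cint (fun x => c * F x) = c * iter_Cint F.
Proof.
move=> [rF iF]; apply/eqP; rewrite eq_complex creM cimM /= -mulNr.
rewrite -!iter_RintZ// -!iter_RintD; try exact: integrandZ.
apply/andP; split; apply/eqP/eq_iter_Rint => x; first by rewrite creM mulNr.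
by rewrite cimM.
Qed.

Lemma cintegrand0 : cintegrand (fun _ => 0).
Proof.
suff h : integrand k (fun _ : nat -> R => 0) by [].
split; first by move=> u x _; exact: cvg_cst.
by exists 0 => x; rewrite normr0 mul0r.
Qed.

Lemma iter_Cint0 : iter_Cint (fun _ => 0) = 0.
Proof.
rewrite -[RHS](mul0r (iter_Cint (fun=> 0))) -(iter_CintZ _ cintegrand0).
by apply: eq_iter_Cint => x; rewrite mul0r.
Qed.

Lemma cintegrand_sum (I : Type) (r : seq I) (F : I -> (nat -> R) -> R[i]) :
  (forall i, cintegrand (F i)) -> cintegrand (fun x => \sum_(i <- r) F i x).
Proof.
move=> IF; elim: r => [|a r IH].
  rewrite (_ : (fun x => _) = fun _ => 0); first exact: cintegrand0.
  by apply/funext => x; rewrite big_nil.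
rewrite (_ : (fun x => _) = fun x => F a x + \sum_(i <- r) F i x).
  exact: cintegrandD.
by apply/funext => x; rewrite big_cons.
Qed.

Lemma iter_Cint_sum (I : Type) (r : seq I) (F : I -> (nat -> R) -> R[i]) :
  (forall i, cintegrand (F i)) ->
  iter_Cint (fun x => \sum_(i <- r) F i x) = \sum_(i <- r) iter_Cint (F i).
Proof.
move=> IF; elim: r => [|a r IH].
  by rewrite big_nil -[RHS]iter_Cint0; apply: eq_iter_Cint => x; rewrite big_nil.
rewrite big_cons -IH -iter_CintD//; last exact: cintegrand_sum.
by apply: eq_iter_Cint => x; rewrite big_cons.
Qed.

Lemma iter_Cint_conj F : cintegrand F ->
  iter_Cint (fun x => Num.conj (F x)) = Num.conj (iter_Cint F).
Proof.
move=> [rF iF]; apply/eqP; rewrite eq_complex /=; apply/andP; split; apply/eqP.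
  by apply: eq_iter_Rint => x; rewrite conjcE; case: (F x).
rewrite -mulN1r -iter_RintZ//; apply: eq_iter_Rint => x.
by rewrite conjcE mulN1r; case: (F x).
Qed.

End ComplexIntegral.

(** * Integration by parts against a Gaussian weight *)

Section GaussianParts.
Context {R : realType}.
Variable p : nat.
Let k := (2 * p)%N.
Implicit Types (F G H Q : (nat -> R) -> R[i]) (x : nat -> R).

Lemma cintegrand_gauss F (q : (nat -> R) -> R) : cpolyg p F -> seqcont q -> coercive k q ->
  cintegrand k (fun x => F x * (expR (- q x))%:C%C).
Proof.
move=> [rF iF] cq qc; split.
  by apply: eq_integrand (integrand_gauss rF cq qc) => x; rewrite creM /= mulr0 subr0.
by apply: eq_integrand (integrand_gauss iF cq qc) => x; rewrite cimM /= mulr0 add0r.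
Qed.

Lemma gauss_pderiv0 i (f f' q q' : (nat -> R) -> R) : (i < k)%N ->
  polyg k f -> polyg k f' -> polyg k q -> polyg k q' -> coercive k q ->
  pderiv i f f' -> pderiv i q q' ->
  iter_Rint k (fun x => (f' x - f x * q' x) * expR (- q x)) = 0.
Proof.
move=> ik pf pf' pq pq' cq df dq.
apply: (@iter_Rint_pderiv _ _ i (fun x => f x * expR (- q x))) => //.
- by apply: integrand_gauss => //; case: pq.
- apply: integrand_gauss => //; last by case: pq.
  by apply: polygD => //; apply: polygN; exact: polygM.
- apply: eq_pderiv (pderivM df (pderiv_expRN dq)) => x //.
  by ring.
Qed.

Lemma integrand_gauss_pderiv (f f' q q' : (nat -> R) -> R) :
  polyg k f -> polyg k f' -> polyg k q -> polyg k q' -> coercive k q ->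
  integrand k (fun x => (f' x - f x * q' x) * expR (- q x)).
Proof.
move=> pf pf' pq pq' cq; apply: integrand_gauss => //; last by case: pq.
by apply: polygD => //; apply: polygN; exact: polygM.
Qed.

(** The integrand is twice the conjugate derivative of F exp(-Q). As [Q] is real, its real and
    imaginary parts each combine one real integration by parts in coordinate 2j with one in
    coordinate 2j+1. *)
Lemma gauss_wirtinger0 (j : 'I_p) F G Q H : wirtinger j F G -> wirtinger j Q H ->
  (forall x, complex.Im (Q x) = 0) -> coercive k (fun x => complex.Re (Q x)) ->
  iter_Cint k (fun x => (G x - F x * H x) * (expR (- complex.Re (Q x)))%:C%C) = 0.
Proof.
move=> [[prF piF] [Fx [Fy [[prFx piFx] [prFy piFy] [drFx diFx] [drFy diFy] ->]]]].
move=> [[prQ piQ] [Qx [Qy [[prQx _] [prQy _] [drQx diQx] [drQy diQy] ->]]]] Q0 cQ.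
have [h1 h2] := coord_lt j.
have ImQx x : complex.Im (Qx x) = 0.
  have := pderiv_cst_eq0 (eq_pderiv Q0 (fun=> erefl) diQx).
  by move=> /(congr1 (fun f => f x)).
have ImQy x : complex.Im (Qy x) = 0.
  have := pderiv_cst_eq0 (eq_pderiv Q0 (fun=> erefl) diQy).
  by move=> /(congr1 (fun f => f x)).
apply/eqP; rewrite eq_complex /=; apply/andP; split; apply/eqP.
  have I2 := integrand_gauss_pderiv piF piFy prQ prQy cQ.
  have := iter_RintD (integrand_gauss_pderiv prF prFx prQ prQx cQ) (integrandZ (-1) I2).
  rewrite (iter_RintZ _ I2) (gauss_pderiv0 h1 prF prFx prQ prQx cQ drFx drQx).
  rewrite (gauss_pderiv0 h2 piF piFy prQ prQy cQ diFy drQy) mulr0 addr0 => e.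
  rewrite -[RHS]e; apply: eq_iter_Rint => x.
  rewrite !(creM, creD, creN, cimM, cimD, cimN) /= ImQx ImQy.
  by ring.
have := iter_RintD (integrand_gauss_pderiv piF piFx prQ prQx cQ)
  (integrand_gauss_pderiv prF prFy prQ prQy cQ).
rewrite (gauss_pderiv0 h1 piF piFx prQ prQx cQ diFx drQx).
rewrite (gauss_pderiv0 h2 prF prFy prQ prQy cQ drFy drQy) addr0 => e.
rewrite -[RHS]e; apply: eq_iter_Rint => x.
rewrite !(creM, creD, creN, cimM, cimD, cimN) /= ImQx ImQy.
by ring.
Qed.

End GaussianParts.

(** * The Hermitian form and Wick's recursion *)

Section HermitianForm.
Context {R : realType}.
Variables (p : nat) (Sigma : 'M[R[i]]_p).
Hypothesis hS : hpd Sigma.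
Implicit Types (u v w z : 'cV[R[i]]_p).

Definition herm_form (S : 'M[R[i]]_p) u v := (map_mx Num.conj u^T *m S *m v) ord0 ord0.

Lemma herm_formDl S u v w : herm_form S (u + v) w = herm_form S u w + herm_form S v w.
Proof. by rewrite /herm_form linearD /= map_mxD !mulmxDl mxE. Qed.

Lemma herm_formDr S u v w : herm_form S u (v + w) = herm_form S u v + herm_form S u w.
Proof. by rewrite /herm_form mulmxDr mxE. Qed.

Lemma herm_formZl S c u w : herm_form S (c *: u) w = Num.conj c * herm_form S u w.
Proof. by rewrite /herm_form linearZ /= map_mxZ -!scalemxAl mxE. Qed.

Lemma herm_formZr S c u w : herm_form S u (c *: w) = c * herm_form S u w.
Proof. by rewrite /herm_form -!scalemxAr mxE. Qed.

Lemma Sigma_conj : map_mx Num.conj Sigma^T = Sigma.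
Proof.
have [] := hS; rewrite qualifE /= => /eqP; rewrite expr0 scale1r => hE _.
exact: esym hE.
Qed.

Lemma herm_form_conj u v : herm_form Sigma u v = Num.conj (herm_form Sigma v u).
Proof.
rewrite /herm_form.
(* Reading the scalar as a 1x1 matrix lets the conjugate transpose distribute over the product. *)
have -> (M : 'M[R[i]]_1) : Num.conj (M ord0 ord0) = (map_mx Num.conj M^T) ord0 ord0.
  by rewrite !mxE.
rewrite trmx_mul trmx_mul !map_mxM Sigma_conj mulmxA.
rewrite [in RHS](_ : map_mx _ (map_mx _ v^T)^T = v)//.
by apply/matrixP => a b; rewrite !mxE; exact: conjcK.
Qed.

Lemma herm_form_ge0 v : 0 <= herm_form Sigma v v.
Proof.
have [->|v0] := eqVneq v 0; first by rewrite /herm_form mulmx0 mxE.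
exact/ltW/(proj2 hS).
Qed.

(** A nonzero row of the kernel of [Sigma^T] would, once transposed, be a vector v with Sigma v = 0,
    against v* Sigma v > 0. *)
Lemma Sigma_unit : Sigma \in unitmx.
Proof.
rewrite -unitmx_tr -row_free_unit -kermx_eq0; apply/eqP/row_matrixP => i.
rewrite row0; apply/eqP; apply: contraT => r0.
have /(proj2 hS) : (row i (kermx Sigma^T))^T != 0 by rewrite trmx_eq0.
rewrite -mulmxA (_ : Sigma *m _ = 0) ?mulmx0 ?mxE ?ltxx//.
apply: trmx_inj; rewrite trmx_mul trmxK trmx0.
by apply/eqP; rewrite -sub_kermx row_sub.
Qed.

Let e_ h : 'cV[R[i]]_p := delta_mx h ord0.

Lemma herm_form_delta h w : herm_form Sigma (e_ h) w = (Sigma *m w) h ord0.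
Proof.
rewrite /herm_form -mulmxA trmx_delta map_delta_mx.
by rewrite -rowE mxE.
Qed.

Lemma Sigma_diag_gt0 h : 0 < Sigma h h.
Proof.
have : 0 < herm_form Sigma (e_ h) (e_ h).
  apply: (proj2 hS); apply/eqP => /matrixP/(_ h ord0).
  by rewrite !mxE !eqxx => /eqP; rewrite oner_eq0.
by rewrite herm_form_delta -colE mxE.
Qed.

(** The substitution w = Sigma^-1 z carries positivity from [Sigma] to its inverse. It rests on
    Sigma^-1 being Hermitian, which follows by conjugate transposition of Sigma Sigma^-1 = 1. *)
Lemma herm_form_inv z : herm_form (invmx Sigma) z z =
  herm_form Sigma (invmx Sigma *m z) (invmx Sigma *m z).
Proof.
rewrite /herm_form trmx_mul map_mxM -!mulmxA (mulKVmx Sigma_unit).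
suff -> : map_mx Num.conj (invmx Sigma)^T = invmx Sigma by [].
have := congr1 (fun M => map_mx Num.conj M^T) (mulmxV Sigma_unit).
rewrite trmx_mul map_mxM Sigma_conj trmx1 map_mx1 => /(canRL (mulmxK Sigma_unit)).
by rewrite mul1mx.
Qed.

(* Cauchy-Schwarz for e_h and w = Sigma^-1 z: their form is z_h. *)
Lemma coord_le_herm_form_inv h z :
  z h ord0 * Num.conj (z h ord0) <= Sigma h h * herm_form (invmx Sigma) z z.
Proof.
set w := invmx Sigma *m z; set s := Sigma h h; set a := z h ord0.
have s0 : 0 < s := Sigma_diag_gt0 h.
have ew : herm_form Sigma (e_ h) w = a by rewrite herm_form_delta mulKVmx// Sigma_unit.
have we : herm_form Sigma w (e_ h) = Num.conj a by rewrite herm_form_conj ew.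
have ee : herm_form Sigma (e_ h) (e_ h) = s by rewrite herm_form_delta -colE mxE.
(* Subtracting the projection of w on e_h, whose coefficient is a / s, makes the inequality
   sharp. *)
have := herm_form_ge0 (w + (- (a / s)) *: e_ h).
rewrite !(herm_formDl, herm_formDr, herm_formZl, herm_formZr) ew we ee -herm_form_inv.
rewrite rmorphN rmorphM fmorphV /= [Num.conj s](geC0_conj (ltW s0)).
set X := (X in 0 <= X).
have -> : X = s^-1 * (s * herm_form (invmx Sigma) z z - a * Num.conj a).
  by rewrite /X; field; rewrite gt_eqF.
by rewrite pmulr_rge0 ?invr_gt0// subr_ge0.
Qed.

End HermitianForm.

(** * Unnormalised Gaussian moments and their recursion *)

Section Wick.
Context {R : realType}.
Variables (p : nat) (Sigma : 'M[R[i]]_p).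
Hypothesis hS : hpd Sigma.
Let k := (2 * p)%N.
Implicit Types (n m : 'I_p -> nat) (x : nat -> R).

Definition quad x : R[i] := herm_form (invmx Sigma) (zvec p x) (zvec p x).

Lemma quadE x : quad x = \sum_b \sum_a
  (invmx Sigma a b * (Num.conj (zcoord x a) * zcoord x b)).
Proof.
rewrite /quad /herm_form mxE; apply: eq_bigr => b _; rewrite mxE big_distrl /=.
by apply: eq_bigr => a _; rewrite !mxE mulrA [invmx _ _ _ * _]mulrC.
Qed.

Lemma quad_ge0 x : 0 <= quad x.
Proof. by rewrite /quad (herm_form_inv hS); exact: herm_form_ge0. Qed.

Lemma Im_quad x : complex.Im (quad x) = 0.
Proof. exact/ger0_Im/quad_ge0. Qed.

(** In each product conj(z_a) z_b only the conjugate factor contributes, and only for a = j; what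
    remains is row j of Sigma^-1 applied to z. *)
Lemma wirtinger_quad j :
  wirtinger j quad (fun x => 2 * (invmx Sigma *m zvec p x) j ord0).
Proof.
apply: eq_wirtinger (wirtinger_sum _ (fun b => wirtinger_sum _ (fun a =>
  wirtingerZ (invmx Sigma a b) (wirtingerM (wirtinger_zconj j a) (wirtinger_zcoord j b))))).
  by move=> x; rewrite quadE.
move=> x /=; rewrite mxE big_distrr /=; apply: eq_bigr => b _.
rewrite (bigD1 j)//= big1 => [|a /negbTE aj]; last by rewrite aj !(mulr0, mul0r, add0r).
by rewrite eqxx !mxE mulr0 !addr0 mulr1 [RHS]mulrCA.
Qed.

Lemma sqn_double q x : sqn (2 * q) x =
  \sum_(h < q) (x (2 * h)%N ^+ 2 + x (2 * h).+1 ^+ 2).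
Proof.
elim: q => [|q IH]; first by rewrite muln0 /sqn !big_ord0.
rewrite mulnS /sqn !big_ord_recr /= -IH /sqn.
by rewrite addrA !mul2n.
Qed.

Lemma coercive_quad : coercive k (fun x => complex.Re (quad x)).
Proof.
(* Summing |z_h|^2 <= sigma_hh q(z) over h bounds |z|^2 by the trace times q(z). The added 1 keeps
   the divisor positive even for an empty trace. *)
pose S := 1 + \sum_(h < p) complex.Re (Sigma h h).
have sg h : 0 <= complex.Re (Sigma h h).
  by have := Sigma_diag_gt0 hS h; rewrite ltcE => /andP[_ /ltW].
have S0 : 0 < S by rewrite ltr_wpDr// sumr_ge0.
exists S^-1; first by rewrite invr_gt0.
move=> x; rewrite mulrC ler_pdivrMr// mulrC.
have q0 : 0 <= complex.Re (quad x).
  by have := quad_ge0 x; rewrite lecE => /andP[].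
rewrite /S mulrDl mul1r sqn_double.
suff : \sum_(h < p) (x (2 * h)%N ^+ 2 + x (2 * h).+1 ^+ 2) <=
    \sum_(h < p) complex.Re (Sigma h h) * complex.Re (quad x).
  by move=> /le_trans -> //; rewrite -big_distrl lerDr.
apply: ler_sum => h _.
have := coord_le_herm_form_inv hS h (zvec p x).
rewrite -/(quad x) lecE => /andP[_].
rewrite creM mxE conjcE /= creM.
have := Sigma_diag_gt0 hS h; rewrite ltcE => /andP[/eqP -> _].
by rewrite mul0r subr0 mulrN opprK -!expr2.
Qed.

Definition monomial n m x : R[i] :=
  \prod_(j < p) (zcoord x j ^+ n j * Num.conj (zcoord x j) ^+ m j).

Definition incr n (h : 'I_p) : 'I_p -> nat := fun j => (n j + (j == h))%N.
(** The subtraction truncates at 0, but in the recursion that case carries the coefficient 0. *)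
Definition decr n (h : 'I_p) : 'I_p -> nat := fun j => (n j - (j == h))%N.

Lemma wirtinger_monomial j n m : wirtinger j (monomial n m)
  (fun x => 2 * (m j)%:R * monomial n (decr m j) x).
Proof.
have d0 : wirtinger j (fun x => \prod_(i < p | i != j)
    (zcoord x i ^+ n i * Num.conj (zcoord x i) ^+ m i)) (fun _ => 0).
  apply: wirtinger_prod0 => i ij.
  apply: eq_wirtinger (wirtingerM (wirtingerX (n i) (wirtinger_zcoord j i))
    (wirtingerX (m i) (wirtinger_zconj j i))) => x //=.
  by rewrite (negbTE ij) !(mulr0, mul0r, addr0).
apply: eq_wirtinger (wirtingerM (wirtingerM (wirtingerX (n j) (wirtinger_zcoord j j))
    (wirtingerX (m j) (wirtinger_zconj j j))) d0) => x.
  by rewrite /monomial [RHS](bigD1 j).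
rewrite /monomial [in RHS](bigD1 j)//= eqxx /decr eqxx subn1.
rewrite [in RHS](eq_bigr (fun i => zcoord x i ^+ n i * Num.conj (zcoord x i) ^+ m i)).
  by rewrite (mulr1 2); ring.
by move=> i /negbTE ->; rewrite subn0.
Qed.

Lemma monomial_incr n m h x : monomial (incr n h) m x = zcoord x h * monomial n m x.
Proof.
rewrite /monomial (bigD1 h)//= [in RHS](bigD1 h)//= /incr eqxx addn1 exprS !mulrA.
congr (_ * _); apply: eq_bigr => i /negbTE ->.
by rewrite addn0.
Qed.

Definition gauss x : R[i] := (expR (- complex.Re (quad x)))%:C%C.

Definition moment n m := iter_Cint k (fun x => monomial n m x * gauss x).

(** The index [j] gives access to the growth bounds contained in [wirtinger_monomial] and
    [wirtinger_quad]. *)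
Lemma cintegrand_moment (j : 'I_p) n m : cintegrand k (fun x => monomial n m x * gauss x).
Proof.
apply: cintegrand_gauss coercive_quad; first by case: (wirtinger_monomial j n m).
by have [[[]]] := wirtinger_quad j.
Qed.

Lemma wick n m h : moment (incr n h) m =
  \sum_j Sigma h j * (m j)%:R * moment n (decr m j).
Proof.
pose mu : 'cV[R[i]]_p := \col_i moment (incr n i) m.
pose nu : 'cV[R[i]]_p := \col_j ((m j)%:R * moment n (decr m j)).
(* Row j of this system is integration by parts in conj(z_j); the inverse matrix comes from
   differentiating the quadratic form. *)
suff nuE : nu = invmx Sigma *m mu.
  have := congr1 (mulmx Sigma) nuE; rewrite mulKVmx ?Sigma_unit//.
  move=> /matrixP/(_ h ord0); rewrite !mxE => <-.
  by apply: eq_bigr => j _; rewrite !mxE mulrA.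
apply/matrixP => j o; rewrite (ord1 o) !mxE {o}.
have e := gauss_wirtinger0 (wirtinger_monomial j n m) (wirtinger_quad j) Im_quad coercive_quad.
have I l l' := cintegrand_moment j l l'.
have : iter_Cint k (fun x => 2 * (m j)%:R * (monomial n (decr m j) x * gauss x) +
    \sum_i -2 * invmx Sigma j i * (monomial (incr n i) m x * gauss x)) = 0.
  rewrite -[RHS]e; apply: eq_iter_Cint => x; rewrite mulrBl mulrA; congr (_ + _).
  rewrite mxE big_distrr big_distrr big_distrl -sumrN; apply: eq_bigr => i _ /=.
  by rewrite monomial_incr !mxE /gauss; ring.
have IS i := cintegrandZ (-2 * invmx Sigma j i) (I (incr n i) m).
rewrite iter_CintD ?iter_CintZ ?iter_Cint_sum//; last 2 first.
- exact: cintegrandZ.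
- exact: cintegrand_sum.
move=> /eqP; rewrite addr_eq0 -sumrN -mulrA => /eqP e2.
apply: (@mulfI _ 2); first by rewrite pnatr_eq0.
rewrite e2 big_distrr; apply: eq_bigr => i _ /=.
by rewrite iter_CintZ// mxE !mulNr opprK mulrA.
Qed.

(** The Gaussian weight is real, so conjugation only exchanges the exponents; the recursion thereby
    becomes available on the side of [m]. *)
Lemma moment_conj (j : 'I_p) n m : moment n m = Num.conj (moment m n).
Proof.
rewrite /moment -iter_Cint_conj; last exact: cintegrand_moment.
apply: eq_iter_Cint => x; rewrite rmorphM /= [Num.conj (gauss x)]conjc_real.
congr (_ * _); rewrite /monomial rmorph_prod; apply: eq_bigr => i _.
rewrite rmorphM !rmorphXn /= mulrC; congr (_ * _ ^+ _).
exact/esym/conjcK.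
Qed.

Lemma CNmomentE (j : 'I_p) n m : CNmoment Sigma n m =
  (((pi : R) ^+ p)%:C%C * \det Sigma)^-1 * moment n m.
Proof.
rewrite /moment -iter_CintZ; last exact: cintegrand_moment.
rewrite /CNmoment -/(iter_Cint k (CNintegrand Sigma n m)); apply: eq_iter_Cint => x.
by rewrite /CNintegrand /CNdensity mulrA [RHS]mulrC.
Qed.

Lemma moment_neq0_balanced (A B : {set 'I_p}) n m :
  (forall h j, n h != 0%N -> m j != 0%N -> Sigma h j != 0 -> (h \in A) = (j \in B)) ->
  moment n m != 0 -> (\sum_(h in A) n h = \sum_(j in B) m j)%N.
Proof.
have [N] := ubnP (\sum_h n h); elim: N n m => // N IH n m; rewrite ltnS => nN AB nz.
have sum_decr (P : pred 'I_p) l h : l h != 0%N ->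
    (\sum_(i | P i) l i = \sum_(i | P i) decr l h i + P h)%N.
  move=> lh; rewrite (_ : nat_of_bool (P h) = \sum_(i | P i) (i == h))%N.
    by rewrite -big_split; apply: eq_bigr => i _; rewrite /decr; case: eqP => [->|_] /=; lia.
  have [Ph|Ph] := boolP (P h).
    by rewrite (bigD1 h)//= eqxx big1// => i /andP[_ /negbTE ->].
  by rewrite big1// => i Pi; case: eqP Pi Ph => // -> ->.
have decrK l h : l h != 0%N -> incr (decr l h) h = l.
  move=> lh; apply/funext => i; rewrite /incr /decr; case: eqP => [->|_]; lia.
have [/existsP[h nh]|] := boolP [exists h, n h != 0%N].
  move: nz; rewrite -(decrK n h nh) wick => nz.
  have /existsP[j] : [exists j, Sigma h j * (m j)%:R * moment (decr n h) (decr m j) != 0].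
    apply: contraNT nz; rewrite negb_exists => /forallP z.
    by rewrite big1// => j _; apply/eqP; have := z j; rewrite negbK.
  rewrite !mulf_eq0 !negb_or pnatr_eq0 => /andP[/andP[shj mj] nz'].
  rewrite decrK// (sum_decr (mem A) n h nh) (sum_decr (mem B) m j mj) /=.
  rewrite (AB h j)//; congr (_ + _)%N.
  apply: IH => //.
    have := sum_decr xpredT n h nh.
    by move: nN => /[swap] ->; rewrite addn1.
  (* Lowering exponents only shrinks the supports, so the compatibility of A and B persists. *)
  move=> a b na mb; apply: AB.
    by apply: contraNneq na => na; rewrite /decr na.
  by apply: contraNneq mb => mb; rewrite /decr mb.
rewrite negb_exists => /forallP n0.
have n0' h : n h = 0%N by apply/eqP; have := n0 h; rewrite negbK.
rewrite big1 => [|h _]; last exact: n0'.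
have [/existsP[j mj]|] := boolP [exists j, m j != 0%N].
  (* With [n = 0] and some m_j nonzero, expanding the conjugate moment gives only coefficients n_i =
     0, so the moment would vanish. *)
  move: nz; rewrite (moment_conj j) -(decrK m j mj) wick big1 ?rmorph0 ?eqxx// => i _.
  by rewrite n0' mulr0 mul0r.
rewrite negb_exists => /forallP m0.
by rewrite big1// => j _; apply/eqP; have := m0 j; rewrite negbK.
Qed.

End Wick.

Theorem theorem3p11 (R : realType) (p : nat) (Sigma : 'M[R[i]]_p)
    (n m : 'I_p -> nat) :
  hpd Sigma ->
  ((exists2 h, h \in Nset n & SN Sigma m h = finset.set0) \/
   (exists2 k, k \in Mset m & SM Sigma n k = finset.set0)) \/
  ((forall h, h \in Nset n -> SN Sigma m h != finset.set0) /\
   exists2 Mr, Mr \in partM Sigma n m &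
     (\sum_(i in Nset n | SN Sigma m i \subset Mr) n i
        != \sum_(j in Mr) m j)%N) ->
  CNmoment Sigma n m = 0.
Proof.
move=> hS.
have balanced (j : 'I_p) (A B : {set 'I_p}) :
    (forall h k, n h != 0%N -> m k != 0%N -> Sigma h k != 0 -> (h \in A) = (k \in B)) ->
    (\sum_(h in A) n h != \sum_(k in B) m k)%N -> CNmoment Sigma n m = 0.
  move=> AB; rewrite (CNmomentE hS j) => /eqP nAB; apply/eqP; rewrite mulf_eq0 orbC.
  by apply/orP; left; apply: contra_notT nAB; exact: moment_neq0_balanced.
case=> [[[h]|[k]]|[_ [Mr]]].
- rewrite inE => nh S0; apply: (balanced h [set h]%SET finset.set0) => [i k ni mk sik|].
    rewrite !inE; apply/eqP => ih.
    have : k \in SN Sigma m h by rewrite !inE mk -ih sik.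
    by rewrite S0 inE.
  by rewrite big_set1 big_set0.
- rewrite inE => mk S0; apply: (balanced k finset.set0 [set k]%SET) => [h i nh mi shi|].
    rewrite !inE; apply/esym/eqP => ik.
    have : h \in SM Sigma n k by rewrite !inE nh -ik shi.
    by rewrite S0 inE.
  by rewrite big_set1 big_set0 eq_sym.
(* A block of the partition is the set of elements of M connected to some x in M. *)
- move=> /imsetP[x xM ->] nsum.
  apply: (balanced x [set i in Nset n | SN Sigma m i \subset
      [set y in Mset m | connect (adjM Sigma n m) x y]]%SET
      [set y in Mset m | connect (adjM Sigma n m) x y]%SET) => [h k nh mk shk|].
    rewrite !inE nh mk /=; apply/fintype.subsetP/idP => [sub|xk k'].
      by have := sub k; rewrite !inE mk shk => /(_ isT).
    (* Both [k] and [k'] lie in S^N_h, so [h] witnesses their adjacency and [k'] stays in the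
       component of x. *)
    move=> k'S; move: (k'S); rewrite !inE => /andP[mk' shk']; rewrite mk' /=.
    apply: connect_trans xk (connect1 _); apply/existsP; exists h.
    by rewrite !inE nh mk shk mk' shk'.
  by rewrite (eq_bigl (fun i => (i \in Nset n) && (SN Sigma m i \subset
    [set y in Mset m | connect (adjM Sigma n m) x y]%SET)))// => i; rewrite inE.
Qed.
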